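(* Let $\mathbf{k}$ be a field and let $H$ be a Hopf algebra over $\mathbf{k}$. Every (right) partial $H$-comodule algebra $(A,\overline{\rho})$ has a globalization (enveloping coaction) $(B,\rho)$; that is, there exist a right $H$-comodule algebra $(B,\rho)$ and an algebra monomorphism $\theta: A\to B$ such that: (1) $\theta(A)$ is a right ideal of $B$ which is a unital algebra with unity $\theta(1_A)$; (2) $B$ is generated by $\theta(A)$ as an $H$-comodule; (3) $(\theta\otimes I)\overline{\rho}(a) = (\theta(1_A)\otimes 1_H)\,\rho(\theta(a))$ for every $a\in A$.
   Context: All algebras are associative algebras over the field $\mathbf{k}$, and $\otimes=\otimes_{\mathbf{k}}$; $\Delta,\epsilon$ denote the comultiplication and counit of $H$, and $I$ denotes an identity map. A (right) partial $H$-comodule algebra is a unital algebra $A$ (with unity $1_A$) together with a linear map $\overline{\rho}: A\to A\otimes H$ such that, for all $a,b\in A$: (i) $\overline{\rho}(ab)=\overline{\rho}(a)\overline{\rho}(b)$; (ii) $(I\otimes\epsilon)\overline{\rho}(a)=a$; (iii) $(\overline{\rho}\otimes I)\overline{\rho}(a)=(\overline{\rho}(1_A)\otimes 1_H)\,\big((I\otimes\Delta)\overline{\rho}(a)\big)$. It is not required that $\overline{\rho}(1_A)=1_A\otimes 1_H$. A right $H$-comodule algebra $(B,\rho)$ is an algebra $B$ (here not necessarily unital) which is a right $H$-comodule via a multiplicative map $\rho:B\to B\otimes H$ (with $\rho(1_B)=1_B\otimes 1_H$ if $B$ has a unity $1_B$). Algebra monomorphisms $A\to B$ are injective multiplicative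 linear maps, not required to preserve a unity. ''$B$ is generated by $\theta(A)$ as an $H$-comodule'' means that the smallest $H$-subcomodule of $B$ containing $\theta(A)$ is $B$. *)

(* Defs.v *)
From HB Require Import structures.
From mathcomp Require Import all_boot all_algebra.
From mathcomp Require Import generic_quotient.
From mathcomp Require Import boolp classical_sets.

Set Implicit Arguments.
Unset Strict Implicit.
Unset Printing Implicit Defensive.

Import GRing.Theory.
Local Open Scope ring_scope.
Local Open Scope quotient_scope.
Local Open Scope classical_set_scope.


Section Tensor.
Variables (k : fieldType) (U V : lmodType k).

(* A list [:: (u_1, v_1); ...; (u_n, v_n)] stands for the formal sum of the
   u_i (x) v_i; no scalars are needed, since c (u (x) v) = (c u) (x) v.
   [tens_rel] is the congruence on formal sums generated by bilinearity. *)
Inductive tens_rel : seq (U * V) -> seq (U * V) -> Prop :=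
| tr_refl s : tens_rel s s
| tr_sym s t : tens_rel s t -> tens_rel t s
| tr_trans s t r : tens_rel s t -> tens_rel t r -> tens_rel s r
| tr_cat s s' t t' :
    tens_rel s s' -> tens_rel t t' -> tens_rel (s ++ t) (s' ++ t')
| tr_comm s t : tens_rel (s ++ t) (t ++ s)
| tr_0 v : tens_rel [:: (0, v)] [::]
| tr_Dl u u' v : tens_rel [:: (u + u', v)] [:: (u, v); (u', v)]
| tr_Dr u v v' : tens_rel [:: (u, v + v')] [:: (u, v); (u, v')]
| tr_Z c u v : tens_rel [:: (c *: u, v)] [:: (u, c *: v)].

Definition tens_eq : rel (seq (U * V)) := fun s t => `[< tens_rel s t >].

Lemma tens_eq_equiv : equiv_class_of tens_eq.
Proof.
split.
- by move=> s; apply/asboolP; exact: tr_refl.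
- by move=> s t; apply/asboolP/asboolP; exact: tr_sym.
- move=> t s r /asboolP st /asboolP tr; apply/asboolP; exact: tr_trans tr.
Qed.

Canonical tens_equiv := EquivRelPack tens_eq_equiv.

Definition tensor := {eq_quot tens_equiv}.

HB.instance Definition _ := Choice.on tensor.
HB.instance Definition _ := EqQuotient.on tensor.

Lemma tens_piP s t : reflect (\pi_tensor s = \pi_tensor t) `[< tens_rel s t >].
Proof. exact: (@eqquotP _ tens_equiv tensor s t). Qed.

Lemma tens_pi s t : tens_rel s t -> \pi_tensor s = \pi_tensor t.
Proof. by move=> st; apply/tens_piP/asboolP. Qed.

Lemma tens_repr s : tens_rel (repr (\pi_tensor s)) s.
Proof. by apply/asboolP/tens_piP; rewrite reprK. Qed.

Lemma tens_surj (x : tensor) : exists s, x = \pi_tensor s.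
Proof. by exists (repr x); rewrite reprK. Qed.

Definition fscale (c : k) (s : seq (U * V)) := [seq (c *: p.1, p.2) | p <- s].

Lemma fscale_rel c s t : tens_rel s t -> tens_rel (fscale c s) (fscale c t).
Proof.
elim=> [{}s|{}s {}t _|{}s {}t r _ sr _ rt|{}s s' {}t t' _ ss _ tt|{}s {}t|v|u u' v|u v v'|a u v].
- exact: tr_refl.
- exact: tr_sym.
- exact: tr_trans rt.
- by rewrite /fscale !map_cat; exact: tr_cat.
- by rewrite /fscale !map_cat; exact: tr_comm.
- by rewrite /= scaler0; exact: tr_0.
- by rewrite /= scalerDr; exact: tr_Dl.
- exact: tr_Dr.
- by rewrite /= scalerA mulrC -scalerA; exact: tr_Z.
Qed.

Definition tens0 : tensor := \pi_tensor [::].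
Definition tensD (x y : tensor) : tensor := \pi_tensor (repr x ++ repr y).
Definition tensZ (c : k) (x : tensor) : tensor := \pi_tensor (fscale c (repr x)).
Definition tensN (x : tensor) : tensor := tensZ (-1) x.

Lemma tensDE s t : tensD (\pi_tensor s) (\pi_tensor t) = \pi_tensor (s ++ t).
Proof. by apply: tens_pi; apply: tr_cat; exact: tens_repr. Qed.

Lemma tensZE c s : tensZ c (\pi_tensor s) = \pi_tensor (fscale c s).
Proof. by apply: tens_pi; apply: fscale_rel; exact: tens_repr. Qed.

Lemma tensDA : associative tensD.
Proof.
move=> x y z; have [s ->] := tens_surj x; have [t ->] := tens_surj y.
have [r ->] := tens_surj z.
by rewrite (tensDE t r) (tensDE s) (tensDE s t) tensDE catA.
Qed.

Lemma tensDC : commutative tensD.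
Proof. by move=> x y; apply: tens_pi; exact: tr_comm. Qed.

Lemma tens0D : left_id tens0 tensD.
Proof. by move=> x; have [s ->] := tens_surj x; exact: (tensDE [::] s). Qed.

Lemma tensND : left_inverse tens0 tensN tensD.
Proof.
move=> x; have [s ->] := tens_surj x; rewrite /tensN tensZE tensDE.
elim: s => [|p s IHs] //=.
rewrite -cat1s -[p :: s]cat1s catA.
have -> : \pi_tensor (([:: (-1 *: p.1, p.2)] ++ fscale (-1) s) ++ [:: p] ++ s)
    = \pi_tensor (([:: (-1 *: p.1, p.2)] ++ [:: p]) ++ (fscale (-1) s ++ s)).
  by rewrite -!tensDE !tensDA; congr tensD; rewrite -!tensDA;
     congr tensD; exact: tensDC.
rewrite -tensDE IHs [LHS]tensDC tens0D; case: p => u v /=.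
apply: tens_pi; apply: tr_trans (tr_0 v).
by have := tr_sym (tr_Dl (-1 *: u) u v); rewrite scaleN1r addNr.
Qed.

HB.instance Definition _ :=
  GRing.isZmodule.Build tensor tensDA tensDC tens0D tensND.

Lemma tens_addE s t : \pi_tensor s + \pi_tensor t = \pi_tensor (s ++ t).
Proof. exact: tensDE. Qed.

Lemma tens_nilE : \pi_tensor [::] = 0.
Proof. by []. Qed.

Lemma tensZA a b (x : tensor) : tensZ a (tensZ b x) = tensZ (a * b) x.
Proof.
have [s ->] := tens_surj x; rewrite (tensZE b s) !tensZE /fscale -map_comp.
congr (\pi_tensor _).
by apply: eq_map => p /=; rewrite scalerA.
Qed.

Lemma tensZ1 : left_id 1 tensZ.
Proof.
move=> x; have [s ->] := tens_surj x; rewrite tensZE; congr (\pi_tensor _).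
by rewrite /fscale; elim: s => //= -[u v] s ->; rewrite scale1r.
Qed.

Lemma tensZDr : right_distributive tensZ +%R.
Proof.
move=> c x y; have [s ->] := tens_surj x; have [t ->] := tens_surj y.
by rewrite tens_addE (tensZE c s) (tensZE c t) tens_addE tensZE /fscale map_cat.
Qed.

Lemma tensZDl (x : tensor) : {morph tensZ^~ x : a b / a + b}.
Proof.
move=> a b /=; have [s ->] := tens_surj x.
rewrite (tensZE (a + b)) (tensZE a) (tensZE b).
elim: s => [|p s IHs]; first by rewrite tens_nilE addr0.
rewrite /= -cat1s -[(a *: _, _) :: _]cat1s -[(b *: _, _) :: _]cat1s.
rewrite -!tens_addE IHs scalerDl addrACA; congr (_ + _).
by rewrite tens_addE; apply: tens_pi; exact: tr_Dl.
Qed.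

HB.instance Definition _ :=
  GRing.Zmodule_isLmodule.Build k tensor tensZA tensZ1 tensZDr tensZDl.

Definition pure (u : U) (v : V) : tensor := \pi_tensor [:: (u, v)].

Lemma pureDl u u' v : pure (u + u') v = pure u v + pure u' v.
Proof. by rewrite tens_addE; apply: tens_pi; exact: tr_Dl. Qed.

Lemma pureDr u v v' : pure u (v + v') = pure u v + pure u v'.
Proof. by rewrite tens_addE; apply: tens_pi; exact: tr_Dr. Qed.

Lemma pureZl c u v : pure (c *: u) v = c *: pure u v.
Proof. by rewrite /pure [RHS]tensZE. Qed.

Lemma pureZr c u v : pure u (c *: v) = c *: pure u v.
Proof. by rewrite -pureZl; apply: tens_pi; apply: tr_sym; exact: tr_Z. Qed.

Lemma tensE (x : tensor) : x = \sum_(p <- repr x) pure p.1 p.2.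
Proof.
rewrite -[LHS]reprK; elim: (repr x) => [|[u v] s IHs]; first by rewrite big_nil.
by rewrite big_cons -IHs tens_addE.
Qed.

Lemma tens_ind (P : tensor -> Prop) :
  P 0 -> (forall x y, P x -> P y -> P (x + y)) ->
  (forall u v, P (pure u v)) -> forall x, P x.
Proof.
move=> P0 PD Pp x; rewrite [x]tensE.
elim: (repr x) => [|p s IHs]; first by rewrite big_nil.
by rewrite big_cons; exact: PD.
Qed.

Definition bilinear_fun (W : lmodType k) (f : U -> V -> W) : Prop :=
  (forall v, linear (f^~ v)) /\ (forall u, linear (f u)).

(* The linear map induced by a bilinear f; it is only meaningful (independent
   of the chosen representative) when f is bilinear. *)
Definition tlift (W : lmodType k) (f : U -> V -> W) (x : tensor) : W :=
  \sum_(p <- repr x) f p.1 p.2.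

Section Lift.
Variables (W : lmodType k) (f : U -> V -> W).
Hypothesis fB : bilinear_fun f.

Lemma bilinear_funDl u u' v : f (u + u') v = f u v + f u' v.
Proof. by have := fB.1 v 1 u u'; rewrite !scale1r. Qed.

Lemma bilinear_funDr u v v' : f u (v + v') = f u v + f u v'.
Proof. by have := fB.2 u 1 v v'; rewrite !scale1r. Qed.

Lemma bilinear_fun0l v : f 0 v = 0.
Proof. by apply: (addrI (f 0 v)); rewrite -bilinear_funDl !addr0. Qed.

Lemma bilinear_fun0r u : f u 0 = 0.
Proof. by apply: (addrI (f u 0)); rewrite -bilinear_funDr !addr0. Qed.

Lemma bilinear_funZl c u v : f (c *: u) v = c *: f u v.
Proof. by have := fB.1 v c u 0; rewrite bilinear_fun0l !addr0. Qed.

Lemma bilinear_funZr c u v : f u (c *: v) = c *: f u v.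
Proof. by have := fB.2 u c v 0; rewrite bilinear_fun0r !addr0. Qed.

Lemma tens_rel_sum s t : tens_rel s t ->
  \sum_(p <- s) f p.1 p.2 = \sum_(p <- t) f p.1 p.2.
Proof.
elim=> [//|//|{}s {}t r _ -> _ ->//|{}s s' {}t t' _ e _ e'|{}s {}t|v|u u' v|u v v'|a u v].
- by rewrite !big_cat /= e e'.
- by rewrite !big_cat /= addrC.
- by rewrite big_seq1 big_nil bilinear_fun0l.
- by rewrite big_seq1 !big_cons big_nil addr0 bilinear_funDl.
- by rewrite big_seq1 !big_cons big_nil addr0 bilinear_funDr.
- by rewrite !big_seq1 bilinear_funZl bilinear_funZr.
Qed.

Lemma tlift_pi s : tlift f (\pi_tensor s) = \sum_(p <- s) f p.1 p.2.
Proof. by apply: tens_rel_sum; exact: tens_repr. Qed.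

Lemma tlift_pure u v : tlift f (pure u v) = f u v.
Proof. by rewrite tlift_pi big_seq1. Qed.

Lemma tlift_linear : linear (tlift f).
Proof.
move=> c x y; have [s ->] := tens_surj x; have [t ->] := tens_surj y.
rewrite [c *: _]tensZE tens_addE !tlift_pi big_cat big_map scaler_sumr.
by congr (_ + _); apply: eq_bigr => p _; rewrite bilinear_funZl.
Qed.

Lemma tlift_unique (g : tensor -> W) : linear g ->
  (forall u v, g (pure u v) = f u v) -> g =1 tlift f.
Proof.
move=> gl gp; have gD x y : g (x + y) = g x + g y.
  by have := gl 1 x y; rewrite !scale1r.
have g0 : g 0 = 0 by apply: (addrI (g 0)); rewrite -gD !addr0.
move=> x; rewrite {1}[x]tensE /tlift (big_morph g gD g0).
by apply: eq_bigr => p _.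
Qed.

End Lift.

Lemma pure_bilinear : bilinear_fun pure.
Proof. by split=> [v|u] c x y /=; rewrite (pureDl, pureDr) (pureZl, pureZr). Qed.

End Tensor.

Arguments tensor {k} (U V)%_type_scope.

Notation "U ⊗ V" := (tensor U V) (at level 40, left associativity) : type_scope.
Notation "u ⊗ v" := (pure u v) (at level 40, left associativity) : ring_scope.

Section TensorMaps.
Variable k : fieldType.
Implicit Types U V W : lmodType k.

Definition tmap U V U' V' (f : U -> U') (g : V -> V') : U ⊗ V -> U' ⊗ V' :=
  tlift (fun u v => f u ⊗ g v).

Definition tassoc U V W : (U ⊗ V) ⊗ W -> U ⊗ (V ⊗ W) :=
  tlift (fun x w => tlift (fun u v => u ⊗ (v ⊗ w)) x).

Definition tens1r U : U ⊗ k^o -> U := tlift (fun u (c : k^o) => c *: u).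

Definition tens1l U : k^o ⊗ U -> U := tlift (fun (c : k^o) u => c *: u).

Definition tmul U V (mU : U -> U -> U) (mV : V -> V -> V) (x y : U ⊗ V) : U ⊗ V :=
  tlift (fun u v => tlift (fun u' v' => mU u u' ⊗ mV v v') y) x.

Lemma lift_bilinear_param U V W W' (F : W' -> U -> V -> W) :
  (forall w, bilinear_fun (F w)) -> (forall u v, linear (fun w => F w u v)) ->
  forall x, linear (fun w => tlift (F w) x).
Proof.
move=> FB Fl x c w w'; rewrite /tlift scaler_sumr -big_split /=.
by apply: eq_bigr => p _; rewrite Fl.
Qed.

Lemma tmap_bilinear U V U' V' (f : {linear U -> U'}) (g : {linear V -> V'}) :
  bilinear_fun (fun u v => f u ⊗ g v).
Proof.
by split=> [v|u] c x y /=; rewrite linearP (pureDl, pureDr) (pureZl, pureZr).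
Qed.

Lemma tmap_pure U V U' V' (f : {linear U -> U'}) (g : {linear V -> V'}) u v :
  tmap f g (u ⊗ v) = f u ⊗ g v.
Proof. by rewrite /tmap tlift_pure //; exact: tmap_bilinear. Qed.

Lemma tmap_linear U V U' V' (f : {linear U -> U'}) (g : {linear V -> V'}) :
  linear (tmap f g).
Proof. by apply: tlift_linear; exact: tmap_bilinear. Qed.

Lemma tassoc_bilinear_in U V W (w : W) :
  bilinear_fun (fun (u : U) (v : V) => u ⊗ (v ⊗ w)).
Proof.
by split=> [v|u] c x y /=; rewrite !(pureDl, pureDr, pureZl, pureZr).
Qed.

Lemma tassoc_bilinear U V W :
  bilinear_fun (fun (x : U ⊗ V) (w : W) => tlift (fun u v => u ⊗ (v ⊗ w)) x).
Proof.
split=> [w|x]; first by apply: tlift_linear; exact: tassoc_bilinear_in.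
apply: lift_bilinear_param => [w|u v c w w'].
  exact: tassoc_bilinear_in.
by rewrite !(pureDr, pureZr).
Qed.

Lemma tassoc_pure U V W (u : U) (v : V) (w : W) :
  tassoc ((u ⊗ v) ⊗ w) = u ⊗ (v ⊗ w).
Proof.
rewrite /tassoc tlift_pure; last exact: tassoc_bilinear.
by rewrite tlift_pure //; exact: tassoc_bilinear_in.
Qed.

Lemma tassoc_linear U V W : linear (@tassoc U V W).
Proof. by apply: tlift_linear; exact: tassoc_bilinear. Qed.

Lemma tens1r_bilinear U : bilinear_fun (fun (u : U) (c : k^o) => c *: u).
Proof.
split=> [c|u] a x y /=; first by rewrite scalerDr !scalerA mulrC.
by rewrite scalerDl -scalerA.
Qed.

Lemma tens1r_pure U (u : U) (c : k^o) : tens1r (u ⊗ c) = c *: u.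
Proof. by rewrite /tens1r tlift_pure //; exact: tens1r_bilinear. Qed.

Lemma tens1r_linear U : linear (@tens1r U).
Proof. by apply: tlift_linear; exact: tens1r_bilinear. Qed.

Lemma tens1l_bilinear U : bilinear_fun (fun (c : k^o) (u : U) => c *: u).
Proof. by case: (tens1r_bilinear U) => hl hr; split. Qed.

Lemma tens1l_pure U (u : U) (c : k^o) : tens1l (c ⊗ u) = c *: u.
Proof. by rewrite /tens1l tlift_pure //; exact: tens1l_bilinear. Qed.

Lemma tens1l_linear U : linear (@tens1l U).
Proof. by apply: tlift_linear; exact: tens1l_bilinear. Qed.

Section Mul.
Variables (U V : lmodType k) (mU : U -> U -> U) (mV : V -> V -> V).
Hypotheses (mUB : bilinear_fun mU) (mVB : bilinear_fun mV).

Lemma tmul_bilinear_in u v :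
  bilinear_fun (fun (u' : U) (v' : V) => mU u u' ⊗ mV v v').
Proof.
split=> [v'|u'] c x y /=.
  by rewrite (mUB.2 u) pureDl pureZl.
by rewrite (mVB.2 v) pureDr pureZr.
Qed.

Lemma tmul_bilinear_out y :
  bilinear_fun (fun u v => tlift (fun u' v' => mU u u' ⊗ mV v v') y).
Proof.
split=> [v|u].
  apply: (@lift_bilinear_param _ _ _ _ (fun u u' v' => mU u u' ⊗ mV v v')).
    by move=> u; exact: tmul_bilinear_in.
  by move=> u' v' c x x'; rewrite (mUB.1 u') pureDl pureZl.
apply: (@lift_bilinear_param _ _ _ _ (fun v u' v' => mU u u' ⊗ mV v v')).
  by move=> v; exact: tmul_bilinear_in.
by move=> u' v' c x x'; rewrite (mVB.1 v') pureDr pureZr.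
Qed.

Lemma tmul_pure u v u' v' :
  tmul mU mV (u ⊗ v) (u' ⊗ v') = mU u u' ⊗ mV v v'.
Proof.
rewrite /tmul tlift_pure; last exact: tmul_bilinear_out.
by rewrite tlift_pure //; exact: tmul_bilinear_in.
Qed.

Lemma tmul_bilinear : bilinear_fun (tmul mU mV).
Proof.
split=> [y|x]; first by apply: tlift_linear; exact: tmul_bilinear_out.
move=> c y y'; rewrite /tmul /tlift scaler_sumr -big_split /=.
apply: eq_bigr => p _; exact: (tlift_linear (tmul_bilinear_in p.1 p.2)).
Qed.

Lemma tmulA : associative mU -> associative mV -> associative (tmul mU mV).
Proof.
have mB := tmul_bilinear.
move=> UA VA x y z; elim/tens_ind: x => [|x x' IHx IHx'|u v].
- by rewrite !(bilinear_fun0l mB).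
- by rewrite !(bilinear_funDl mB) IHx IHx'.
elim/tens_ind: y => [|y y' IHy IHy'|u' v'].
- by rewrite (bilinear_fun0l mB) !(bilinear_fun0r mB) (bilinear_fun0l mB).
- by rewrite (bilinear_funDl mB) !(bilinear_funDr mB) IHy IHy' (bilinear_funDl mB).
elim/tens_ind: z => [|z z' IHz IHz'|u'' v''].
- by rewrite !(bilinear_fun0r mB).
- by rewrite !(bilinear_funDr mB) IHz IHz'.
by rewrite !tmul_pure UA VA.
Qed.

End Mul.
End TensorMaps.


(* [algType] requires 1 != 0, which is no restriction here: counit 1 = 1. *)
HB.mixin Record Algebra_isHopf (k : fieldType) H of GRing.Algebra k H := {
  comul : H -> H ⊗ H;
  counit : H -> k;
  antipode : H -> H;
  comul_linear : linear comul;
  counit_scalar : scalar counit;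
  antipode_linear : linear antipode;
  comulA : forall x,
    tassoc (tmap comul idfun (comul x)) = tmap idfun comul (comul x);
  comul_counitl : forall x,
    tens1l (tmap (counit : H -> k^o) idfun (comul x)) = x;
  comul_counitr : forall x,
    tens1r (tmap idfun (counit : H -> k^o) (comul x)) = x;
  comulM : forall x y, comul (x * y) = tmul *%R *%R (comul x) (comul y);
  comul1 : comul 1 = 1 ⊗ 1;
  counitM : forall x y, counit (x * y) = counit x * counit y;
  counit1 : counit 1 = 1;
  antipodel : forall x,
    tlift *%R (tmap antipode idfun (comul x)) = counit x *: 1;
  antipoder : forall x,
    tlift *%R (tmap idfun antipode (comul x)) = counit x *: 1
}.

#[short(type="hopfAlgType")]
HB.structure Definition HopfAlgebra (k : fieldType) :=
  {H of GRing.Algebra k H & Algebra_isHopf k H}.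

Section HopfLinear.
Variables (k : fieldType) (H : hopfAlgType k).

HB.instance Definition _ :=
  GRing.isLinear.Build k H (H ⊗ H)%type _ (@comul k H) (@comul_linear k H).
HB.instance Definition _ :=
  GRing.isLinear.Build k H k^o _ (@counit k H : H -> k^o) (@counit_scalar k H).
HB.instance Definition _ :=
  GRing.isLinear.Build k H H _ (@antipode k H) (@antipode_linear k H).

End HopfLinear.


HB.mixin Record Lmodule_isNUAlgebra (k : fieldType) A of GRing.Lmodule k A := {
  nmul : A -> A -> A;
  nmulA : associative nmul;
  nmul_bilinear : bilinear_fun nmul
}.

#[short(type="nuAlgType")]
HB.structure Definition NUAlgebra (k : fieldType) :=
  {A of GRing.Lmodule k A & Lmodule_isNUAlgebra k A}.

Notation "a ∙ b" := (nmul a b) (at level 40, left associativity) : ring_scope.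

(* Unital algebras are represented as a [nuAlgType] with a unity, rather than
   as an [algType], because the latter excludes the zero algebra. *)
Definition is_unity (k : fieldType) (A : nuAlgType k) (e : A) : Prop :=
  forall a : A, e ∙ a = a /\ a ∙ e = a.

Section Coactions.
Variables (k : fieldType) (H : hopfAlgType k).

Definition mulAH (A : nuAlgType k) : A ⊗ H -> A ⊗ H -> A ⊗ H :=
  tmul (@nmul k A) *%R.

Definition mulAHH (A : nuAlgType k) :
    A ⊗ (H ⊗ H) -> A ⊗ (H ⊗ H) -> A ⊗ (H ⊗ H) :=
  tmul (@nmul k A) (tmul *%R *%R).

Record partial_comodule_algebra (A : nuAlgType k) (oneA : A)
    (rhoA : {linear A -> (A ⊗ H)%type}) : Prop := {
  pca_unity : is_unity oneA;
  pca_mul : forall a b, rhoA (a ∙ b) = mulAH (rhoA a) (rhoA b);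
  pca_counit : forall a,
    tens1r (tmap idfun (@counit k H : H -> k^o) (rhoA a)) = a;
  pca_coassoc : forall a,
    tassoc (tmap rhoA idfun (rhoA a)) =
    mulAHH (tassoc (rhoA oneA ⊗ (1 : H))) (tmap idfun (@comul k H) (rhoA a))
}.

Record comodule_algebra (B : nuAlgType k)
    (rho : {linear B -> (B ⊗ H)%type}) : Prop := {
  ca_coassoc : forall b,
    tassoc (tmap rho idfun (rho b)) = tmap idfun (@comul k H) (rho b);
  ca_counit : forall b,
    tens1r (tmap idfun (@counit k H : H -> k^o) (rho b)) = b;
  ca_mul : forall b c, rho (b ∙ c) = mulAH (rho b) (rho c);
  ca_unity : forall e, is_unity e -> rho e = e ⊗ (1 : H)
}.

Definition subspace (V : lmodType k) (M : set V) : Prop :=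
  M 0 /\ forall (c : k) x y, M x -> M y -> M (c *: x + y).

(* The image of M (x) H in B (x) H. *)
Definition tens_sub (B : nuAlgType k) (M : set B) : set (B ⊗ H) :=
  [set x | exists s : seq (B * H),
     (forall p, p \in s -> M p.1) /\ x = \sum_(p <- s) p.1 ⊗ p.2].

Definition subcomodule (B : nuAlgType k) (rho : {linear B -> (B ⊗ H)%type})
    (M : set B) : Prop :=
  subspace M /\ forall b, M b -> tens_sub M (rho b).

Definition smallest_subcomodule (B : nuAlgType k)
    (rho : {linear B -> (B ⊗ H)%type}) (S M : set B) : Prop :=
  [/\ subcomodule rho M, S `<=` M &
      forall N, subcomodule rho N -> S `<=` N -> M `<=` N].

Definition right_ideal (B : nuAlgType k) (J : set B) : Prop :=
  subspace J /\ forall x b : B, J x -> J (x ∙ b).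

Definition unity_of (B : nuAlgType k) (S : set B) (e : B) : Prop :=
  S e /\ forall x, S x -> e ∙ x = x /\ x ∙ e = x.

Record globalization (A : nuAlgType k) (oneA : A)
    (rhoA : {linear A -> (A ⊗ H)%type}) (B : nuAlgType k)
    (rho : {linear B -> (B ⊗ H)%type}) (theta : {linear A -> B}) : Prop := {
  gl_comodule_algebra : comodule_algebra rho;
  gl_inj : injective theta;
  gl_mul : forall a b, theta (a ∙ b) = theta a ∙ theta b;
  gl_right_ideal : right_ideal (range theta);
  gl_unity : unity_of (range theta) (theta oneA);
  gl_generated : smallest_subcomodule rho (range theta) setT;
  gl_restrict : forall a,
    tmap theta idfun (rhoA a) =
    mulAH (theta oneA ⊗ (1 : H)) (rho (theta a))
}.

End Coactions.

(* Main.v *)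
(* A is embedded by its partial coaction into the comodule algebra A ⊗ H with
   coaction I ⊗ Δ, and B is the subcomodule generated by the image θ(A): the
   span of the slices (I ⊗ f)ρ(θ(a)), with f a linear functional on H. By the
   partial coassociativity, θ(1)B is contained in θ(A), so θ(A)B is contained in
   θ(A); with the antipode, (I ⊗ f)ρ(x) b is the sum of the
   (I ⊗ f(- S(b_1)))ρ(x b_0), hence B is closed under products.
   Over a field, functionals separate the points of the second tensor factor;
   this is why slices detect membership in M ⊗ H for a subspace M. *)
Require Import Defs.
From HB Require Import structures.
From mathcomp Require Import all_boot all_algebra.
From mathcomp Require Import boolp classical_sets.

Set Implicit Arguments.
Unset Strict Implicit.
Unset Printing Implicit Defensive.

Import GRing.Theory.
Local Open Scope ring_scope.
Local Open Scope classical_set_scope.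

(** * Subspaces and separating functionals *)

Section Subspaces.
Variables (k : fieldType) (V : lmodType k) (M : set V).
Hypothesis subM : subspace M.

Lemma subspaceD x y : M x -> M y -> M (x + y).
Proof. by move=> Mx My; rewrite -[x]scale1r; exact: subM.2. Qed.

Lemma subspaceZ c x : M x -> M (c *: x).
Proof. by move=> Mx; rewrite -[_ *: _]addr0; apply: subM.2 => //; exact: subM.1. Qed.

Lemma subspace_sum (I : eqType) (s : seq I) (F : I -> V) :
  (forall i, i \in s -> M (F i)) -> M (\sum_(i <- s) F i).
Proof.
by move=> MF; rewrite big_seq; elim/big_rec: _ => [|i x /MF];
  [exact: subM.1|exact: subspaceD].
Qed.

(* A subspace maximal among those containing [M] but not [w] is a hyperplane
   complementary to the line through [w]. *)
Lemma subspace_separation (w : V) : ~ M w ->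
  exists f : {linear V -> k^o}, f w = 1 /\ forall x, M x -> f x = 0.
Proof.
move=> Mw.
pose P := [set X : set V | X = set0 \/ [/\ subspace X, M `<=` X & ~ X w]].
have [F FP totF|X [PX maxX]] := @Zorn_bigcup V P.
  have [[X0 FX0 [x0 X0x0]]|noF] := pselect (exists2 X, F X & X !=set0); last first.
    left; apply/seteqP; split=> [x [X FX Xx]|//].
    by case: noF; exists X => //; exists x.
  have FN X : F X -> X !=set0 -> [/\ subspace X, M `<=` X & ~ X w].
    by move=> /FP[-> [x []]|].
  have [[X00 _] MX0 _] := FN _ FX0 (ex_intro _ _ X0x0).
  right; split; last by move=> [X FX Xw]; have [_ _] := FN X FX (ex_intro _ _ Xw).
    split=> [|c x y [X FX Xx] [Y FY Yy]]; first by exists X0.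
    have [[_ ZX] _ _] := FN X FX (ex_intro _ _ Xx).
    have [[_ ZY] _ _] := FN Y FY (ex_intro _ _ Yy).
    case: (totF _ _ FX FY) => sub; [exists Y|exists X] => //.
      by apply: ZY => //; exact: sub.
    by apply: ZX => //; exact: sub.
  by move=> x Mx; exists X0 => //; exact: MX0.
have [subX MX Xw] : [/\ subspace X, M `<=` X & ~ X w].
  case: PX => // X0; case: (maxX M); last by right; split.
  by rewrite X0; split=> // /(_ _ subM.1).
have wX c : X (c *: w) -> c = 0.
  have [//|c0] := eqVneq c 0.
  move=> /(subX.2 c^-1 _ 0)/(_ subX.1).
  by rewrite scalerA mulVf // scale1r addr0 => /Xw.
have span x : exists c, X (x - c *: w).
  have [Xx|Xx] := pselect (X x); first by exists 0; rewrite scale0r subr0.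
  (* [Y] is the sum of [X] and the line through [x]; by maximality it contains [w], and solving for
     [x] gives the coefficient. *)
  pose Y := [set y | exists c : k, X (y - c *: x)].
  have subY : subspace Y.
    split=> [|c y z [a ya] [b zb]];
      first by exists 0; rewrite scale0r subr0; exact: subX.1.
    exists (c * a + b); have := subX.2 c _ _ ya zb; congr X.
    by rewrite scalerBr scalerA scalerDl opprD addrACA.
  have XY : X `<=` Y by move=> y Xy; exists 0; rewrite scale0r subr0.
  have Yw : Y w.
    apply: contrapT => Yw; apply: (maxX Y); last first.
      by right; split=> // y /MX/XY.
    by split=> // YX; apply: Xx; apply: YX; exists 1; rewrite scale1r subrr; exact: subX.1.
  have [c Xc] := Yw.
  have c0 : c != 0 by apply/eqP => c0; apply: Xw; move: Xc; rewrite c0 scale0r subr0.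
  exists c^-1; have := subX.2 (- c^-1) _ 0 Xc subX.1; congr X.
  by rewrite addr0 scalerBr scalerA mulNr mulVf // !scaleNr scale1r opprK addrC.
(* By [wX] the coefficient is unique, which is what makes this choice linear. *)
pose f x : k^o := projT1 (cid (span x)).
have fX x : X (x - f x *: w) by rewrite /f; case: cid.
have fE x (c : k) : X (x - c *: w) -> f x = c.
  move=> xc; apply/eqP; rewrite -subr_eq0; apply/eqP; apply: wX.
  have := subX.2 (-1) _ _ (fX x) xc; congr X.
  by rewrite scaleN1r opprB addrA subrK scalerBl.
have flin : linear f.
  move=> c x y; apply: fE; have := subX.2 c _ _ (fX x) (fX y); congr X.
  by rewrite scalerBr scalerA scalerDl opprD addrACA.
pose fL := GRing.isLinear.Build k V k^o _ f flin.
pose g : {linear V -> k^o} := HB.pack f fL.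
exists g; split=> [|x Mx] /=.
  by apply: fE; rewrite scale1r subrr; exact: subX.1.
by apply: fE; rewrite scale0r subr0; exact: MX.
Qed.

End Subspaces.

(** * Slices of tensors by linear functionals *)

Section TensorLinear.
Variable k : fieldType.

HB.instance Definition _ (U V U' V' : lmodType k)
    (f : {linear U -> U'}) (g : {linear V -> V'}) :=
  GRing.isLinear.Build k (U ⊗ V)%type (U' ⊗ V')%type _ (tmap f g)
    (tmap_linear f g).
HB.instance Definition _ (U V W : lmodType k) :=
  GRing.isLinear.Build k ((U ⊗ V) ⊗ W)%type (U ⊗ (V ⊗ W))%type _
    (@tassoc k U V W) (@tassoc_linear k U V W).
HB.instance Definition _ (U : lmodType k) :=
  GRing.isLinear.Build k (U ⊗ k^o)%type U _ (@tens1r k U) (@tens1r_linear k U).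

Lemma pure0l (U V : lmodType k) (v : V) : (0 : U) ⊗ v = 0.
Proof. exact: (bilinear_fun0l (@pure_bilinear k U V)). Qed.

Lemma pure0r (U V : lmodType k) (u : U) : u ⊗ (0 : V) = 0.
Proof. exact: (bilinear_fun0r (@pure_bilinear k U V)). Qed.

End TensorLinear.

Section Slices.
Variables (k : fieldType) (V W : lmodType k).
Implicit Types (t : (V ⊗ W)%type) (f : {linear W -> k^o}) (M : set V).

Definition slice f (t : (V ⊗ W)%type) : V := tens1r (tmap idfun f t).

Lemma slice_linear f : linear (slice f).
Proof. by move=> c x y; rewrite /slice !linearP. Qed.

HB.instance Definition _ f :=
  GRing.isLinear.Build k (V ⊗ W)%type V _ (slice f) (slice_linear f).

Lemma slice_pure f v w : slice f (v ⊗ w) = f w *: v.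
Proof. by rewrite /slice tmap_pure tens1r_pure. Qed.

(** Coefficients are peeled off one vector at a time, to match the term-by-term absorption in
    [in_span_pure]. *)
Fixpoint in_span (l : seq W) (w : W) : Prop :=
  if l is v :: l' then exists c : k, in_span l' (w - c *: v) else w = 0.

Lemma in_span_subspace l : subspace (in_span l : set W).
Proof.
elim: l => [|v l [IH0 IHl]]; split=> //=;
  first by move=> c x y -> ->; rewrite scaler0 addr0.
  by exists 0; rewrite scale0r subr0.
move=> c x y [a xa] [b yb]; exists (c * a + b).
by have := IHl c _ _ xa yb; congr in_span; rewrite scalerBr scalerA scalerDl opprD addrACA.
Qed.

Lemma in_span_mem l w : w \in l -> in_span l w.
Proof.
elim: l => //= v l IH; rewrite inE => /predU1P[->|/IH wl].
  by exists 1; rewrite scale1r subrr; exact: (in_span_subspace l).1.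
by exists 0; rewrite scale0r subr0.
Qed.

(** The term [v ⊗ w] is absorbed without lengthening the sum, since
    [v ⊗ (c *: x) + u ⊗ x = (u + c *: v) ⊗ x]. *)
Lemma in_span_pure (s : seq (V * W)) v w : in_span (map snd s) w ->
  exists2 s' : seq (V * W), size s' = size s &
    v ⊗ w + \sum_(p <- s) p.1 ⊗ p.2 = \sum_(p <- s') p.1 ⊗ p.2.
Proof.
elim: s w => [|[u x] s IHs] w /=.
  by move=> ->; exists [::] => //; rewrite !big_nil pure0r addr0.
move=> [c /IHs[s' ss' e]]; exists ((u + c *: v, x) :: s'); first by rewrite /= ss'.
rewrite !big_cons /= -e -[w in LHS](subrK (c *: x)).
rewrite [v ⊗ (_ + c *: x)]pureDr pureDl pureZr pureZl.
by rewrite addrACA [RHS]addrACA [v ⊗ _ + u ⊗ _]addrC.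
Qed.

(* In a shortest expression of [t] as a sum of [v_i ⊗ w_i], no [w_i] lies in the
   span of the others, so some functional is 1 at [w_i] and 0 at the others. *)
Lemma sum_slices t : exists2 s : seq (V * W), t = \sum_(p <- s) p.1 ⊗ p.2 &
  forall p, p \in s -> exists f, p.1 = slice f t.
Proof.
move: (repr t) (tensE t) => s; have [n] := ubnP (size s).
elim: n s => // n IHn s /ltnSE sn ts.
have [[p ps p_span]|indep] :=
  pselect (exists2 p, p \in s & in_span (map snd (rem p s)) p.2).
  have [s' s's e] := in_span_pure p.1 p_span.
  apply: (IHn s'); last by rewrite ts (big_rem p ps).
  by rewrite s's size_rem //; case: s ps sn {ts p_span s' s's e}.
exists s => // p ps.
have p_indep : ~ in_span (map snd (rem p s)) p.2 by move=> ?; apply: indep; exists p.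
have [f [fp f0]] := subspace_separation (in_span_subspace _) p_indep.
exists f; rewrite ts linear_sum (big_rem p ps) /= slice_pure fp scale1r big_seq.
rewrite big1 ?addr0 // => q qs; rewrite slice_pure f0 ?scale0r //.
by apply: in_span_mem; exact: map_f.
Qed.

(** By [sum_slices] the difference is a sum of pure tensors whose left factors are slices of it, and
    these slices all vanish. *)
Lemma slice_inj t t' : (forall f, slice f t = slice f t') -> t = t'.
Proof.
move=> tt'; apply/subr0_eq; have [s e sl] := sum_slices (t - t').
rewrite e big_seq big1 // => p /sl[f ->].
by rewrite linearB /= tt' subrr pure0l.
Qed.

Lemma slice_sub M (s : seq (V * W)) f : subspace M ->
  (forall p, p \in s -> M p.1) -> M (slice f (\sum_(p <- s) p.1 ⊗ p.2)).
Proof.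
move=> subM Ms; rewrite linear_sum; apply: subspace_sum => // p /Ms Mp /=.
by rewrite slice_pure; exact: subspaceZ.
Qed.

End Slices.

Lemma slice_tmap (k : fieldType) (V W V' W' : lmodType k) (f : {linear V -> V'})
    (g : {linear W -> W'}) (h : {linear W' -> k^o}) t :
  slice h (tmap f g t) = f (slice (h \o g) t).
Proof.
elim/tens_ind: t => [|x y IHx IHy|v w]; first by rewrite !linear0.
  by rewrite !linearD /= IHx IHy.
by rewrite tmap_pure !slice_pure linearZ.
Qed.

(** Flatness over a field: slicing commutes with [f], so injectivity can be tested on slices. *)
Lemma tmap_inj (k : fieldType) (V W V' : lmodType k) (f : {linear V -> V'}) :
  injective f -> injective (tmap f (idfun : {linear W -> W})).
Proof.
move=> finj t t' tt'; apply: slice_inj => g; apply: finj.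
by have := congr1 (slice g) tt'; rewrite !slice_tmap.
Qed.

(** * Products on the tensor product of a nonunital and a unital algebra *)

Section NonunitalAlgebras.
Variable k : fieldType.

Lemma mulr_bilinear (H : algType k) : bilinear_fun ( *%R : H -> H -> H).
Proof.
split=> [v|u] c x y; first by rewrite mulrDl -scalerAl.
by rewrite mulrDr -scalerAr.
Qed.

(** This product unfolds to that of [mulAH], so the coaction axioms can be read with [∙]; the
    instance applies again to [(A ⊗ H) ⊗ H]. *)
HB.instance Definition _ (A : nuAlgType k) (H : algType k) :=
  Lmodule_isNUAlgebra.Build k (A ⊗ H)%type
    (tmulA (@nmul_bilinear k A) (mulr_bilinear H) (@nmulA k A) (@mulrA H))
    (tmul_bilinear (@nmul_bilinear k A) (mulr_bilinear H)).

Lemma nmul_pure (A : nuAlgType k) (H : algType k) (a b : A) (g h : H) :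
  (a ⊗ g) ∙ (b ⊗ h) = (a ∙ b) ⊗ (g * h).
Proof. exact: (tmul_pure (@nmul_bilinear k A) (mulr_bilinear H)). Qed.

Variable A : nuAlgType k.
Implicit Types a b : A.

Lemma nmulDl a a' b : (a + a') ∙ b = a ∙ b + a' ∙ b.
Proof. exact: (bilinear_funDl nmul_bilinear). Qed.

Lemma nmulDr a b b' : a ∙ (b + b') = a ∙ b + a ∙ b'.
Proof. exact: (bilinear_funDr nmul_bilinear). Qed.

Lemma nmulZl c a b : (c *: a) ∙ b = c *: (a ∙ b).
Proof. exact: (bilinear_funZl nmul_bilinear). Qed.

Lemma nmulZr c a b : a ∙ (c *: b) = c *: (a ∙ b).
Proof. exact: (bilinear_funZr nmul_bilinear). Qed.

Lemma nmul0l b : 0 ∙ b = 0.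
Proof. exact: (bilinear_fun0l nmul_bilinear). Qed.

Lemma nmul0r a : a ∙ 0 = 0.
Proof. exact: (bilinear_fun0r nmul_bilinear). Qed.

Lemma nmul_sumr (I : Type) (s : seq I) (F : I -> A) a :
  a ∙ (\sum_(i <- s) F i) = \sum_(i <- s) a ∙ F i.
Proof. exact: (big_morph (nmul a) (nmulDr a) (nmul0r a)). Qed.

End NonunitalAlgebras.

Section TensorProduct.
Variables (k : fieldType) (A : nuAlgType k) (H : algType k).
Implicit Types (a b : A) (t : (A ⊗ H)%type).

Lemma slice_mul_purer (f : {linear H -> k^o}) t b :
  slice f (t ∙ (b ⊗ 1)) = slice f t ∙ b.
Proof.
elim/tens_ind: t => [|x y IHx IHy|a h].
- by rewrite nmul0l linear0 nmul0l.
- by rewrite nmulDl linearD /= IHx IHy linearD nmulDl.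
by rewrite nmul_pure mulr1 !slice_pure nmulZl.
Qed.

Lemma slice_mul_purel (f : {linear H -> k^o}) a t :
  slice f ((a ⊗ 1) ∙ t) = a ∙ slice f t.
Proof.
elim/tens_ind: t => [|x y IHx IHy|b h].
- by rewrite nmul0r linear0 nmul0r.
- by rewrite nmulDr linearD /= IHx IHy linearD nmulDr.
by rewrite nmul_pure mul1r !slice_pure nmulZr.
Qed.

Lemma nmul_pure_unity e t : is_unity e -> t ∙ (e ⊗ 1) = t.
Proof.
move=> e1; elim/tens_ind: t => [|x y IHx IHy|b h]; first by rewrite nmul0l.
  by rewrite nmulDl IHx IHy.
by rewrite nmul_pure mulr1 (e1 b).2.
Qed.

Lemma tmapM (B : nuAlgType k) (f : {linear A -> B}) :
  (forall a b, f (a ∙ b) = f a ∙ f b) ->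
  forall t t', tmap f (idfun : {linear H -> H}) (t ∙ t') =
    tmap f (idfun : {linear H -> H}) t ∙ tmap f (idfun : {linear H -> H}) t'.
Proof.
move=> fM t t'; elim/tens_ind: t => [|x y IHx IHy|a h].
- by rewrite nmul0l linear0 nmul0l.
- by rewrite nmulDl linearD /= IHx IHy linearD nmulDl.
elim/tens_ind: t' => [|x y IHx IHy|b g].
- by rewrite nmul0r linear0 nmul0r.
- by rewrite nmulDr linearD /= IHx IHy linearD nmulDr.
by rewrite nmul_pure !tmap_pure nmul_pure fM.
Qed.

End TensorProduct.

Lemma tmap_comp (k : fieldType) (U V W U' V' W' : lmodType k)
    (f : {linear U -> V}) (g : {linear V -> W})
    (f' : {linear U' -> V'}) (g' : {linear V' -> W'}) t :
  tmap g g' (tmap f f' t) = tmap (g \o f) (g' \o f') t.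
Proof.
elim/tens_ind: t => [|x y IHx IHy|v w]; first by rewrite !linear0.
  by rewrite !linearD /= IHx IHy.
by rewrite !tmap_pure.
Qed.

(** * The antipode and the untwisting of a coaction *)

Section Antipode.
Variables (k : fieldType) (H : hopfAlgType k).

Definition mul_antipode (x : (H ⊗ H)%type) : H :=
  tlift *%R (tmap idfun (@antipode k H) x).

Lemma mul_antipode_linear : linear mul_antipode.
Proof.
move=> c x y; rewrite /mul_antipode linearP.
exact: (tlift_linear (mulr_bilinear H)).
Qed.

HB.instance Definition _ :=
  GRing.isLinear.Build k (H ⊗ H)%type H _ mul_antipode mul_antipode_linear.

Lemma mul_antipode_pure g h : mul_antipode (g ⊗ h) = g * antipode h.
Proof.
by rewrite /mul_antipode tmap_pure (tlift_pure (mulr_bilinear H)).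
Qed.

Variables (E : nuAlgType k) (rho : {linear E -> (E ⊗ H)%type}).

(* [b ⊗ h |-> b_0 ⊗ b_1 S(h)], so that [rho b |-> b_0 ⊗ b_1 S(b_2) = b ⊗ 1]. *)
Definition untwist (t : (E ⊗ H)%type) : (E ⊗ H)%type :=
  tmap idfun mul_antipode (tassoc (tmap rho idfun t)).

Lemma untwist_linear : linear untwist.
Proof. by move=> c x y; rewrite /untwist !linearP. Qed.

HB.instance Definition _ :=
  GRing.isLinear.Build k (E ⊗ H)%type (E ⊗ H)%type _ untwist untwist_linear.

(** On [y ⊗ h] the composite multiplies the [H]-factor of [y] on the right by [antipode h], which
    commutes with left multiplication by [t]. *)
Lemma nmul_untwist t y h :
  t ∙ tmap idfun mul_antipode (tassoc (y ⊗ h)) =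
  tmap idfun mul_antipode (tassoc ((t ∙ y : (E ⊗ H)%type) ⊗ h)).
Proof.
elim/tens_ind: t => [|t t' IH IH'|e g].
- by rewrite !nmul0l pure0l !linear0.
- by rewrite !nmulDl pureDl !linearD IH IH'.
elim/tens_ind: y => [|t t' IH IH'|e' g'].
- by rewrite nmul0r pure0l !linear0 nmul0r.
- by rewrite nmulDr !pureDl !linearD nmulDr IH IH'.
by rewrite nmul_pure !tassoc_pure !tmap_pure nmul_pure /= !mul_antipode_pure mulrA.
Qed.

(** Right multiplication by [antipode h] moves into the functional; this keeps the computation in
    [slice_spanM] among slices of the coaction. *)
Lemma slice_untwist (f : {linear H -> k^o}) h :
  exists f' : {linear H -> k^o}, forall y : (E ⊗ H)%type,
  slice f (tmap idfun mul_antipode (tassoc (y ⊗ h))) = slice f' y.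
Proof.
pose f' g : k^o := f (g * antipode h).
have f'_lin : linear f' by move=> c x y; rewrite /f' mulrDl -scalerAl linearP.
pose f'L := GRing.isLinear.Build k H k^o _ f' f'_lin.
pose F : {linear H -> k^o} := HB.pack f' f'L.
exists F => y; elim/tens_ind: y => [|x y IHx IHy|e g].
- by rewrite pure0l !linear0.
- by rewrite pureDl !linearD /= IHx IHy.
by rewrite tassoc_pure tmap_pure !slice_pure /= mul_antipode_pure.
Qed.

Hypothesis rho_coassoc : forall b,
  tassoc (tmap rho idfun (rho b)) = tmap idfun (@comul k H) (rho b).
Hypothesis rho_counit : forall b,
  tens1r (tmap idfun (@counit k H : H -> k^o) (rho b)) = b.
Hypothesis rhoM : forall b c, rho (b ∙ c) = rho b ∙ rho c.

Lemma untwist_coaction b : untwist (rho b) = b ⊗ 1.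
Proof.
(* Once [b] on the right is recovered from [rho b] by the counit, both sides are linear in [rho b],
   which can be replaced by an arbitrary tensor. *)
rewrite /untwist rho_coassoc -{2}[b]rho_counit.
elim/tens_ind: (rho b) => [|x y IHx IHy|e h].
- by rewrite !linear0 pure0l.
- by rewrite !linearD /= pureDl IHx IHy.
rewrite !tmap_pure tens1r_pure /= /mul_antipode antipoder.
by rewrite pureZl pureZr.
Qed.

(** Since [rho e ∙ rho b = rho (e ∙ b)], left multiplication by [rho e] fixes every [untwist t], in
    particular [e ⊗ 1], the untwisting of [rho e]. But [e ⊗ 1] is a right unity of [E ⊗ H]. *)
Lemma coaction_unity e : is_unity e -> rho e = e ⊗ 1.
Proof.
move=> e1; rewrite -[LHS](nmul_pure_unity _ e1) -untwist_coaction.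
have idem t : rho e ∙ untwist t = untwist t; last exact: idem.
elim/tens_ind: t => [|x y IHx IHy|b h].
- by rewrite linear0 nmul0r.
- by rewrite linearD /= nmulDr IHx IHy.
by rewrite /untwist tmap_pure nmul_untwist -rhoM (e1 b).1.
Qed.

Lemma comodule_algebra_of : comodule_algebra rho.
Proof. by split=> //; exact: coaction_unity. Qed.

End Antipode.

(** * The comodule algebra [A ⊗ H] *)

Section FreeCoaction.
Variables (k : fieldType) (H : hopfAlgType k) (A : nuAlgType k).

Section InverseAssoc.
Variables U V W : lmodType k.

Lemma tassoc_inv_bilinear_in (u : U) :
  bilinear_fun (fun (v : V) (w : W) => (u ⊗ v) ⊗ w).
Proof. by split=> [w|v] c x y /=; rewrite !(pureDl, pureDr, pureZl, pureZr). Qed.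

Lemma tassoc_inv_bilinear :
  bilinear_fun (fun (u : U) => tlift (fun (v : V) (w : W) => (u ⊗ v) ⊗ w)).
Proof.
split=> [x|u]; last by apply: tlift_linear; exact: tassoc_inv_bilinear_in.
apply: (@lift_bilinear_param _ _ _ _ _ (fun u v w => (u ⊗ v) ⊗ w)) => [u|v w c u u'].
  exact: tassoc_inv_bilinear_in.
by rewrite !(pureDl, pureZl).
Qed.

Definition tassoc_inv : U ⊗ (V ⊗ W) -> (U ⊗ V) ⊗ W :=
  tlift (fun u => tlift (fun v w => (u ⊗ v) ⊗ w)).

HB.instance Definition _ :=
  GRing.isLinear.Build k (U ⊗ (V ⊗ W))%type ((U ⊗ V) ⊗ W)%type _ tassoc_inv
    (tlift_linear tassoc_inv_bilinear).

Lemma tassoc_inv_pure u v w : tassoc_inv (u ⊗ (v ⊗ w)) = (u ⊗ v) ⊗ w.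
Proof.
rewrite /tassoc_inv (tlift_pure tassoc_inv_bilinear).
exact: (tlift_pure (tassoc_inv_bilinear_in u)).
Qed.

Lemma tassocK : cancel (@tassoc k U V W) tassoc_inv.
Proof.
elim/tens_ind=> [|x y IHx IHy|x w]; first by rewrite !linear0.
  by rewrite !linearD /= IHx IHy.
elim/tens_ind: x => [|x y IHx IHy|u v].
- by rewrite pure0l !linear0.
- by rewrite pureDl !linearD /= IHx IHy.
by rewrite tassoc_pure tassoc_inv_pure.
Qed.

Lemma tassoc_invK : cancel tassoc_inv (@tassoc k U V W).
Proof.
elim/tens_ind=> [|x y IHx IHy|u x]; first by rewrite !linear0.
  by rewrite !linearD /= IHx IHy.
elim/tens_ind: x => [|x y IHx IHy|v w].
- by rewrite pure0r !linear0.
- by rewrite pureDr !linearD /= IHx IHy.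
by rewrite tassoc_inv_pure tassoc_pure.
Qed.

End InverseAssoc.

(** Partial coassociativity is stated in [A ⊗ (H ⊗ H)] with [mulAHH]; this carries it to the product
    of [(A ⊗ H) ⊗ H]. *)
Lemma tassocM (x y : ((A ⊗ H) ⊗ H)%type) :
  tassoc (x ∙ y) = mulAHH (tassoc x) (tassoc y).
Proof.
have HH := tmul_bilinear (mulr_bilinear H) (mulr_bilinear H).
have B := tmul_bilinear (@nmul_bilinear k A) HH.
elim/tens_ind: x => [|x x' IH IH'|x h].
- by rewrite nmul0l linear0 /mulAHH (bilinear_fun0l B).
- by rewrite nmulDl !linearD /= IH IH' /mulAHH (bilinear_funDl B).
elim/tens_ind: y => [|y y' IH IH'|y g].
- by rewrite nmul0r linear0 /mulAHH (bilinear_fun0r B).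
- by rewrite nmulDr !linearD /= IH IH' /mulAHH (bilinear_funDr B).
rewrite nmul_pure; elim/tens_ind: x => [|x x' IH IH'|a u].
- by rewrite nmul0l pure0l pure0l linear0 /mulAHH (bilinear_fun0l B).
- by rewrite nmulDl !pureDl !linearD /= IH IH' /mulAHH (bilinear_funDl B).
elim/tens_ind: y => [|y y' IH IH'|b v].
- by rewrite nmul0r !pure0l linear0 /mulAHH (bilinear_fun0r B).
- by rewrite nmulDr !pureDl !linearD /= IH IH' /mulAHH (bilinear_funDr B).
rewrite nmul_pure !tassoc_pure /mulAHH (tmul_pure (@nmul_bilinear k A) HH).
by rewrite (tmul_pure (mulr_bilinear H) (mulr_bilinear H)).
Qed.

Definition free_coaction (t : (A ⊗ H)%type) : ((A ⊗ H) ⊗ H)%type :=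
  tassoc_inv (tmap idfun (@comul k H) t).

Lemma free_coaction_linear : linear free_coaction.
Proof. by move=> c x y; rewrite /free_coaction !linearP. Qed.

HB.instance Definition _ :=
  GRing.isLinear.Build k (A ⊗ H)%type ((A ⊗ H) ⊗ H)%type _ free_coaction
    free_coaction_linear.

Lemma tassoc_free_coaction t :
  tassoc (free_coaction t) = tmap idfun (@comul k H) t.
Proof. exact: tassoc_invK. Qed.

Section PureLeft.
Variables (U V : lmodType k) (u : U).

Lemma pure_linear : linear (pure u : V -> (U ⊗ V)%type).
Proof. exact: (@pure_bilinear k U V).2. Qed.

HB.instance Definition _ := GRing.isLinear.Build k V (U ⊗ V)%type _ (pure u) pure_linear.
End PureLeft.

Lemma free_coaction_pure a h :
  free_coaction (a ⊗ h) = tmap (pure a) (idfun : {linear H -> H}) (comul h).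
Proof.
rewrite /free_coaction tmap_pure /=; elim/tens_ind: (comul h) => [|x y IHx IHy|g g'].
- by rewrite !linear0.
- by rewrite !linearD /= IHx IHy.
by rewrite tassoc_inv_pure tmap_pure.
Qed.

Lemma free_coactionA t :
  tassoc (tmap free_coaction idfun (free_coaction t)) =
  tmap idfun (@comul k H) (free_coaction t).
Proof.
elim/tens_ind: t => [|x y IHx IHy|a h]; first by rewrite !linear0.
  by rewrite !linearD /= IHx IHy.
(* By [free_coaction_pure], [pure a] intertwines [comul] with [free_coaction], so coassociativity
   reduces to [comulA]. *)
have nat x : tassoc (tmap free_coaction idfun (tmap (pure a) idfun x)) =
    tmap (pure a) idfun (tassoc (tmap (@comul k H) (idfun : {linear H -> H}) x)).
  elim/tens_ind: x => [|x y IHx IHy|g g']; first by rewrite !linear0.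
    by rewrite !linearD /= IHx IHy.
  rewrite !tmap_pure /= free_coaction_pure.
  elim/tens_ind: (comul g) => [|x y IHx IHy|g1 g2].
  - by rewrite linear0 !pure0l !linear0.
  - by rewrite linearD !pureDl !linearD /= IHx IHy.
  by rewrite tassoc_pure !tmap_pure tassoc_pure.
by rewrite free_coaction_pure nat comulA !tmap_comp.
Qed.

Lemma free_coaction_counit t :
  tens1r (tmap idfun (@counit k H : H -> k^o) (free_coaction t)) = t.
Proof.
elim/tens_ind: t => [|x y IHx IHy|a h]; first by rewrite !linear0.
  by rewrite !linearD /= IHx IHy.
rewrite free_coaction_pure -[in RHS](comul_counitr h).
elim/tens_ind: (comul h) => [|x y IHx IHy|g g'].
- by rewrite !linear0.
- by rewrite !linearD /= IHx IHy.
by rewrite !tmap_pure !tens1r_pure /= pureZr.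
Qed.

Lemma free_coactionM t t' :
  free_coaction (t ∙ t') = free_coaction t ∙ free_coaction t'.
Proof.
have HH := tmul_bilinear (mulr_bilinear H) (mulr_bilinear H).
have B := tmul_bilinear (@nmul_bilinear k A) HH.
apply: (can_inj (@tassocK _ _ _)); rewrite tassocM !tassoc_free_coaction.
elim/tens_ind: t => [|x y IHx IHy|a h].
- by rewrite nmul0l !linear0 /mulAHH (bilinear_fun0l B).
- by rewrite nmulDl !linearD /= IHx IHy /mulAHH (bilinear_funDl B).
elim/tens_ind: t' => [|x y IHx IHy|b g].
- by rewrite nmul0r !linear0 /mulAHH (bilinear_fun0r B).
- by rewrite nmulDr !linearD /= IHx IHy /mulAHH (bilinear_funDr B).
by rewrite nmul_pure !tmap_pure /mulAHH (tmul_pure (@nmul_bilinear k A) HH) /= comulM.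
Qed.

Lemma free_comodule_algebra : comodule_algebra (free_coaction : {linear _ -> _}).
Proof.
apply: comodule_algebra_of;
  [exact: free_coactionA|exact: free_coaction_counit|exact: free_coactionM].
Qed.

(** With [rhoA] itself as the embedding into [A ⊗ H], the partial coassociativity axiom becomes
    condition (3) of a globalization. *)
Lemma partial_coaction_restrict (oneA : A) (rhoA : {linear A -> (A ⊗ H)%type}) a :
  partial_comodule_algebra oneA rhoA ->
  tmap rhoA idfun (rhoA a) = (rhoA oneA ⊗ 1) ∙ free_coaction (rhoA a).
Proof.
case=> _ _ _ coassoc; apply: (can_inj (@tassocK _ _ _)).
by rewrite coassoc tassocM tassoc_free_coaction.
Qed.

End FreeCoaction.

Lemma eq_tmap (k : fieldType) (U V U' V' : lmodType k) (f f' : U -> U')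
    (g g' : V -> V') : f =1 f' -> g =1 g' -> tmap f g =1 tmap f' g'.
Proof. by move=> /funext-> /funext->. Qed.

(** * The subcomodule spanned by slices *)

Section Subcomodules.
Variables (k : fieldType) (H : hopfAlgType k) (E : nuAlgType k).
Variable rho : {linear E -> (E ⊗ H)%type}.
Hypothesis rho_ca : comodule_algebra rho.
Implicit Types (S M : set E) (f g : {linear H -> k^o}).

(** Linear combinations are constructors, so that proofs about the span go by induction instead of
    through explicit finite sums. *)
Inductive slice_span S : set E :=
| slice_span0 : slice_span S 0
| slice_spanP c x y :
    slice_span S x -> slice_span S y -> slice_span S (c *: x + y)
| slice_span_slice f x : S x -> slice_span S (slice f (rho x)).

Lemma slice_span_subspace S : subspace (slice_span S).
Proof. by split=> [|c x y]; [exact: slice_span0|exact: slice_spanP]. Qed.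

(** Slicing [rho x] with the counit returns [x]. *)
Lemma sub_slice_span S : S `<=` slice_span S.
Proof.
move=> x Sx; rewrite -[x](ca_counit rho_ca).
exact: (slice_span_slice (@counit k H : {linear H -> k^o})).
Qed.

(** By coassociativity the two slices merge into [g(x_1) f(x_2) x_0], so [h] is the convolution
    product of [g] and [f]. *)
Lemma slice_coaction_slice f g : exists h : {linear H -> k^o},
  forall x, slice g (rho (slice f (rho x))) = slice h (rho x).
Proof.
pose fg (u v : H) : k^o := g u * f v.
have fgB : bilinear_fun fg.
  split=> [v|u] c x y; rewrite /fg linearP; first by rewrite mulrDl -scalerAl.
  by rewrite mulrDr -scalerAr.
pose fgL := GRing.isLinear.Build k (H ⊗ H)%type k^o _ (tlift fg) (tlift_linear fgB).
pose F : {linear (H ⊗ H)%type -> k^o} := HB.pack (tlift fg) fgL.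
exists (F \o @comul k H) => x.
have /= := slice_tmap idfun (@comul k H) F (rho x).
rewrite -(ca_coassoc rho_ca) => <-.
rewrite -[rho (slice f _)](slice_tmap rho idfun f (rho x)).
elim/tens_ind: (tmap rho idfun (rho x)) => [|y z IHy IHz|y v]; first by rewrite !linear0.
  by rewrite !linearD /= IHy IHz.
rewrite slice_pure linearZ /=; elim/tens_ind: y => [|y z IHy IHz|e u].
- by rewrite pure0l !linear0.
- by rewrite pureDl !linearD /= IHy IHz.
by rewrite tassoc_pure !slice_pure /= (tlift_pure fgB) /fg scalerA mulrC.
Qed.

(** Slices of [rho b] stay in the span, and [sum_slices] writes [rho b] with such slices as left
    factors. *)
Lemma slice_span_subcomodule S : subcomodule rho (slice_span S).
Proof.
split=> [|b Sb]; first exact: slice_span_subspace.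
have closed g : slice_span S (slice g (rho b)).
  elim: Sb => [|c x y _ Sx _ Sy|f x Sx].
  - by rewrite !linear0; exact: slice_span0.
  - by rewrite !linearP; exact: slice_spanP.
  by have [h ->] := slice_coaction_slice f g; exact: slice_span_slice.
have [s bs sl] := sum_slices (rho b).
by exists s; split=> // p /sl[f ->].
Qed.

Lemma subcomodule_slice M f x : subcomodule rho M -> M x -> M (slice f (rho x)).
Proof. by move=> [subM coM] /coM[s [Ms ->]]; exact: slice_sub. Qed.

Lemma slice_spanM S :
  (forall x b, S x -> slice_span S b -> S (x ∙ b)) ->
  forall y b, slice_span S y -> slice_span S b -> slice_span S (y ∙ b).
Proof.
move=> SM y b Sy Sb; elim: Sy => [|c x z _ Sx _ Sz|f x Sx].
- by rewrite nmul0l; exact: slice_span0.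
- by rewrite nmulDl nmulZl; exact: slice_spanP.
(* The product is the slice of [rho x ∙ (b ⊗ 1)], and [b ⊗ 1] is [untwist (rho b)]. *)
have untwist_rho := untwist_coaction (ca_coassoc rho_ca) (ca_counit rho_ca).
rewrite -slice_mul_purer -untwist_rho.
have [s [Ss ->]] := (slice_span_subcomodule S).2 b Sb.
rewrite (linear_sum (untwist rho)) nmul_sumr (linear_sum (slice f)).
apply: subspace_sum => [|p /Ss Sp /=]; first exact: slice_span_subspace.
(* The term of [p] becomes [rho (x ∙ p.1)] with its [H]-factor multiplied by [antipode p.2]; as
   [p.1] lies in the span, [x ∙ p.1] lies in [S]. *)
rewrite /untwist tmap_pure nmul_untwist -[_ ∙ rho _](ca_mul rho_ca).
have [f' ->] := slice_untwist E f p.2.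
by apply: slice_span_slice; exact: SM.
Qed.

End Subcomodules.

(** * Restriction of a comodule algebra to a subalgebra that is a subcomodule *)

Section Subalgebra.
Variables (k : fieldType) (E : nuAlgType k) (M : set E).
Hypothesis subM : subspace M.
Hypothesis mulM : forall x y, M x -> M y -> M (x ∙ y).

Definition in_subalgebra : {pred E} := fun x => `[< M x >].

Lemma in_subalgebraP x : reflect (M x) (x \in in_subalgebra).
Proof. exact: asboolP. Qed.

(** The closure proofs are arguments of the type so that the structures declared on it can recover
    them by unification. *)
Definition subalgebra of subspace M & (forall x y, M x -> M y -> M (x ∙ y)) :=
  {x : E | x \in in_subalgebra}.

Local Notation B := (subalgebra subM mulM).

HB.instance Definition _ := SubChoice.on B.

Lemma in_subalgebra_closed : subsemimod_closed in_subalgebra.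
Proof.
split; first split.
- by apply/in_subalgebraP; exact: subM.1.
- move=> x y /in_subalgebraP ? /in_subalgebraP ?.
  by apply/in_subalgebraP; exact: subspaceD.
- by move=> c x /in_subalgebraP ?; apply/in_subalgebraP; exact: subspaceZ.
Qed.

HB.instance Definition _ :=
  GRing.SubChoice_isSubLmodule.Build k E in_subalgebra B in_subalgebra_closed.

Definition subalgebra_val (x : B) : E := val x.

Lemma subalgebra_val_linear : linear subalgebra_val.
Proof. by move=> c x y; rewrite /subalgebra_val linearP. Qed.

HB.instance Definition _ :=
  GRing.isLinear.Build k B E _ subalgebra_val subalgebra_val_linear.

Lemma subalgebra_val_inj : injective subalgebra_val.
Proof. exact: val_inj. Qed.

Lemma subalgebraP (x : B) : M (subalgebra_val x).
Proof. exact/in_subalgebraP/valP. Qed.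

Definition subalgebra_in x (Mx : M x) : B := Sub x (introT (in_subalgebraP x) Mx).

Lemma subalgebra_inK x (Mx : M x) : subalgebra_val (subalgebra_in Mx) = x.
Proof. exact: SubK. Qed.

Definition subalgebra_mul (x y : B) : B :=
  subalgebra_in (mulM (subalgebraP x) (subalgebraP y)).

Lemma subalgebra_mulA : associative subalgebra_mul.
Proof. by move=> x y z; apply: subalgebra_val_inj; rewrite !subalgebra_inK nmulA. Qed.

Lemma subalgebra_mul_bilinear : bilinear_fun subalgebra_mul.
Proof.
split=> [y|x] c z t; apply: subalgebra_val_inj; rewrite linearP !subalgebra_inK linearP /=.
  by rewrite nmulDl nmulZl.
by rewrite nmulDr nmulZr.
Qed.

HB.instance Definition _ :=
  Lmodule_isNUAlgebra.Build k B subalgebra_mulA subalgebra_mul_bilinear.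

Lemma subalgebra_valM (x y : B) :
  subalgebra_val (x ∙ y) = subalgebra_val x ∙ subalgebra_val y.
Proof. exact: subalgebra_inK. Qed.

Variables (H : hopfAlgType k) (rho : {linear E -> (E ⊗ H)%type}).
Hypothesis rho_ca : comodule_algebra rho.
Hypothesis coM : subcomodule rho M.

Local Notation incl := (tmap subalgebra_val (idfun : H -> H)).

Lemma restricted_coaction_subproof (b : B) : exists t, incl t = rho (subalgebra_val b).
Proof.
have [s [Ms ->]] := coM.2 _ (subalgebraP b).
(* Every left factor lies in [M], so the default value 0 of [insubd] is never taken. *)
exists (\sum_(p <- s) (insubd (0 : B) p.1) ⊗ p.2).
rewrite linear_sum; apply: eq_big_seq => p /Ms Mp /=.
by rewrite tmap_pure; congr (_ ⊗ _); apply: insubdK; exact/in_subalgebraP.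
Qed.

Definition restricted_coaction b := projT1 (cid (restricted_coaction_subproof b)).

Lemma restricted_coactionE b : incl (restricted_coaction b) = rho (subalgebra_val b).
Proof. by rewrite /restricted_coaction; case: cid. Qed.

(** This makes the preimage chosen in [restricted_coaction] unique; its linearity and
    multiplicativity can then be checked in [E ⊗ H]. *)
Lemma incl_inj : injective incl.
Proof. exact/tmap_inj/subalgebra_val_inj. Qed.

Lemma restricted_coaction_linear : linear restricted_coaction.
Proof.
by move=> c x y; apply: incl_inj; rewrite linearP /= !restricted_coactionE !linearP.
Qed.

HB.instance Definition _ :=
  GRing.isLinear.Build k B (B ⊗ H)%type _ restricted_coaction restricted_coaction_linear.

Lemma inclM t t' : incl (t ∙ t') = incl t ∙ incl t'.
Proof. exact: (tmapM subalgebra_valM). Qed.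

Lemma restricted_comodule_algebra :
  comodule_algebra (restricted_coaction : {linear B -> (B ⊗ H)%type}).
Proof.
apply: comodule_algebra_of => [b|b|b c].
(* Coassociativity is compared in [E ⊗ (H ⊗ H)], where that of [rho] applies; what remains is
   naturality of [tassoc] along [subalgebra_val]. *)
- apply: (@tmap_inj _ _ (H ⊗ H)%type _ subalgebra_val subalgebra_val_inj) => /=.
  rewrite tmap_comp.
  rewrite (eq_tmap (f' := idfun \o subalgebra_val) (g' := @comul k H \o idfun)) //.
  rewrite -(tmap_comp subalgebra_val) /= restricted_coactionE.
  rewrite -(ca_coassoc rho_ca) -restricted_coactionE.
  rewrite tmap_comp -(eq_tmap (f := incl \o restricted_coaction)
    (g := idfun \o idfun) restricted_coactionE (frefl _)).
  rewrite -tmap_comp /=.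
  elim/tens_ind: (tmap restricted_coaction _ _) => [|x y IHx IHy|x h].
  + by rewrite !linear0.
  + by rewrite !linearD /= IHx IHy.
  rewrite tmap_pure /=; elim/tens_ind: x => [|x y IHx IHy|x g].
  + by rewrite linear0 !pure0l !linear0.
  + by rewrite linearD !pureDl !linearD /= IHx IHy.
  by rewrite tassoc_pure !tmap_pure tassoc_pure.
- apply: subalgebra_val_inj; rewrite -[RHS](ca_counit rho_ca) -restricted_coactionE.
  exact/esym/(slice_tmap subalgebra_val idfun (@counit k H : {linear H -> k^o})).
by apply: incl_inj;
  rewrite inclM !restricted_coactionE subalgebra_valM [LHS](ca_mul rho_ca).
Qed.

End Subalgebra.

(** * The globalization spanned by slices of the image *)

Section Globalization.
Variables (k : fieldType) (H : hopfAlgType k) (A : nuAlgType k) (oneA : A).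
Variables (rhoA : {linear A -> (A ⊗ H)%type}) (E : nuAlgType k).
Variables (rho : {linear E -> (E ⊗ H)%type}) (theta : {linear A -> E}).
Hypothesis oneAP : is_unity oneA.
Hypothesis rho_ca : comodule_algebra rho.
Hypothesis theta_inj : injective theta.
Hypothesis thetaM : forall a b, theta (a ∙ b) = theta a ∙ theta b.
Hypothesis theta_restrict : forall a,
  tmap theta idfun (rhoA a) = (theta oneA ⊗ 1) ∙ rho (theta a).

Local Notation span := (slice_span rho (range theta)).

(* It suffices to see that [theta oneA] maps the span into [theta A], which
   holds because slicing [theta_restrict] with [f] reads
   [theta oneA ∙ slice f (rho (theta a)) = theta (slice f (rhoA a))]. *)
Lemma range_slice_spanM x b : range theta x -> span b -> range theta (x ∙ b).
Proof.
move=> [a _ <-] span_b; rewrite -[a](oneAP a).2 thetaM -nmulA.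
suff [a' _ <-] : range theta (theta oneA ∙ b) by exists (a ∙ a').
elim: span_b => [|c y z _ [a1 _ e1] _ [a2 _ e2]|f y [a' _ <-]].
- by exists 0; rewrite // linear0 nmul0r.
- by exists (c *: a1 + a2); rewrite // linearP e1 e2 nmulDr nmulZr.
exists (slice f (rhoA a')) => //.
by rewrite -slice_mul_purel -theta_restrict slice_tmap.
Qed.

Let subM := slice_span_subspace rho (range theta).
Let coM := slice_span_subcomodule rho_ca (range theta).
Let mulM := slice_spanM rho_ca range_slice_spanM.

Local Notation B := (subalgebra subM mulM).

Lemma theta_in_span a : span (theta a).
Proof. by apply: (sub_slice_span rho_ca); exists a. Qed.

Definition corestrict a : B := subalgebra_in subM mulM (theta_in_span a).

Lemma corestrictE a : subalgebra_val (corestrict a) = theta a.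
Proof. exact: subalgebra_inK. Qed.

Lemma corestrict_linear : linear corestrict.
Proof.
by move=> c a b; apply: subalgebra_val_inj; rewrite linearP /= !corestrictE linearP.
Qed.

HB.instance Definition _ := GRing.isLinear.Build k A B _ corestrict corestrict_linear.

Lemma slice_span_globalization : globalization oneA rhoA
  (restricted_coaction (mulM := mulM) coM : {linear B -> (B ⊗ H)%type})
  (corestrict : {linear A -> B}).
Proof.
have corestrictM a b : corestrict (a ∙ b) = corestrict a ∙ corestrict b.
  by apply: subalgebra_val_inj; rewrite subalgebra_valM !corestrictE thetaM.
split=> //.
- exact: restricted_comodule_algebra.
- by move=> a b /(congr1 (@subalgebra_val _ _ _ _ _)); rewrite !corestrictE => /theta_inj.
- split=> [|_ b [a _ <-]].
    split=> [|c _ _ [a _ <-] [b _ <-]]; first by exists 0; rewrite // linear0.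
    by exists (c *: a + b); rewrite // linearP.
  have [||a' _ e] := range_slice_spanM (x := theta a) (b := subalgebra_val b).
  + by exists a.
  + exact: subalgebraP.
  by exists a' => //; apply: subalgebra_val_inj; rewrite subalgebra_valM !corestrictE.
- split; first by exists oneA.
  by move=> _ [a _ <-]; rewrite -!corestrictM (oneAP a).1 (oneAP a).2.
- split=> [|//|N subN rangeN b _].
    split=> [|b _]; first by split.
    exists (repr (restricted_coaction (mulM := mulM) coM b)).
    by split=> //; exact: tensE.
  (* The induction is on membership of the value of [b] in the span, with [b] kept general so that
     the summands can be lifted back to [B]. *)
  move: (subalgebraP b); move def_y: (subalgebra_val b) => y span_y.
  elim: span_y b def_y => [|c x z span_x IHx span_z IHz|f _ [a _ <-]] b def_b.
  + have -> : b = 0 by apply: subalgebra_val_inj; rewrite linear0.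
    exact: subN.1.1.
  + have -> : b = c *: subalgebra_in subM mulM span_x + subalgebra_in subM mulM span_z.
      by apply: subalgebra_val_inj; rewrite linearP /= !subalgebra_inK.
    by apply: subN.1.2; [apply: IHx|apply: IHz]; exact: subalgebra_inK.
  (* The slice taken in [E] is the value of the same slice of the restricted coaction, and [N] is
     closed under slices. *)
  have -> : b = slice f (restricted_coaction (mulM := mulM) coM (corestrict a)).
    apply: subalgebra_val_inj; rewrite def_b -corestrictE.
    rewrite -(restricted_coactionE (mulM := mulM) coM).
    exact: slice_tmap.
  by apply: (subcomodule_slice _ subN); apply: rangeN; exists a.
(* Condition (3) is tested in [E ⊗ H], where it is [theta_restrict]. *)
move=> a; apply: (@incl_inj _ _ _ subM mulM).
rewrite [RHS]inclM tmap_pure restricted_coactionE /= !corestrictE -theta_restrict.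
rewrite tmap_comp; apply: eq_tmap => // x; exact: corestrictE.
Qed.

End Globalization.

Theorem theorem4 (k : fieldType) (H : hopfAlgType k) (A : nuAlgType k)
    (oneA : A) (rhoA : {linear A -> (A ⊗ H)%type}) :
  partial_comodule_algebra oneA rhoA ->
  exists (B : nuAlgType k) (rho : {linear B -> (B ⊗ H)%type})
         (theta : {linear A -> B}),
    globalization oneA rhoA rho theta.
Proof.
move=> rhoA_pca; have [oneAP rhoAM rhoA_counit _] := rhoA_pca.
(* The counit axiom provides a left inverse of [rhoA]. *)
have rhoA_inj : injective rhoA.
  exact: (can_inj (g := fun t => tens1r (tmap idfun (@counit k H : H -> k^o) t))).
(* Here [E] is [A ⊗ H] with [free_coaction], and [theta] is [rhoA]. *)
do 3!eexists; apply: (slice_span_globalization oneAP _ rhoA_inj rhoAM).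
  exact: free_comodule_algebra.
by move=> a; exact: partial_coaction_restrict.
Qed.
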